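(* Let $X=(X,\phi,\varepsilon(X))$ be an exterior discrete semi-flow and denote $D=D(X)$, $\check D=\check D(X)$, $D^S=D^S(X)$. Then we have the following induced partitions of $X$: $$X=(X\setminus D)\sqcup\Big(\bigsqcup_{a\in{}^{\omega}\pi_0^{BG}(X)}D_a\Big),$$ $$X=(X\setminus\check D)\sqcup\Big(\bigsqcup_{a\in{}^{\omega}\check\pi_0(X)}\check D_a\Big),$$ $$X=(X\setminus D^S)\sqcup\Big(\bigsqcup_{a\in{}^{\omega}\pi_0^S(X)}D^S_a\Big),$$ where $X\setminus D$, $X\setminus\check D$ and $\check D_a$ are completely invariant and $D^S_a$ is right-invariant.
   Context: $\mathbb{N}=\{0,1,2,\dots\}$, $\mathbb{R}_+=[0,\infty)$. An externology on a topological space $X$ is a non-empty collection $\varepsilon(X)$ of open subsets, closed under finite intersections, such that any open set containing a member of $\varepsilon(X)$ belongs to $\varepsilon(X)$; $(X,\varepsilon(X))$ is then an exterior space. A map of exterior spaces is exterior if it is continuous and preimages of members of the target externology belong to the source externology. $\mathbb{N}$ and $\mathbb{R}_+$ carry the usual topologies and the externologies of open sets whose complement is closed and compact. For an exterior space $X$ and $I=[0,1]$, $X\bar\times I$ is the product space with externology consisting of the open $E\subset X\times I$ such that for each $t\in I$ there are an open neighborhood $U_t$ of $t$ and $T^t\in\varepsilon(X)$ with $T^t\times U_t\subset E$. Exterior maps $f,g\colon X\to Y$ are exterior homotopic if there is an exterior map $X\bar\times I\to Y$ which is a homotopy from $f$ to $g$; $[f]$ is the exterior homotopy class of $f$. A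 discrete semi-flow on $X$ is a continuous map $\phi\colon\mathbb{N}\times X\to X$ with $\phi(0,x)=x$ and $\phi(n,\phi(m,x))=\phi(n+m,x)$; write $\phi^n(x)=\phi_x(n)=\phi(n,x)$. An exterior discrete semi-flow is an exterior space with a discrete semi-flow such that $\phi^1$ is exterior. A subset $A\subset X$ is right-invariant if $\phi^1(A)\subset A$, left-invariant if $(\phi^1)^{-1}(A)\subset A$, and completely invariant if both. End sets: $\pi_0^{BG}(X)$ is the set of exterior homotopy classes of exterior maps $\mathbb{N}\to X$; $\pi_0^S(X)$ is the set of exterior homotopy classes of exterior maps $\mathbb{R}_+\to X$; $\check\pi_0(X)=\lim_{E\in\varepsilon(X)}\pi_0(E)$, where $\pi_0$ is the set of path components, so $a\in\check\pi_0(X)$ is a family $(C_E)_{E\in\varepsilon(X)}$ with $C_E$ a path component of $E$ and $C_{E'}\subset C_E$ if $E'\subset E$. The map $\eta_X\colon\pi_0^S(X)\to\check\pi_0(X)$ sends $[\alpha]$ to the family $(C_E)$ where $C_E$ is the path component of $E$ containing $\alpha(r)$ for all sufficiently large $r$. $D(X)=\{x\in X\mid\phi_x\colon\mathbb{N}\to X\text{ is exterior}\}$, and $\omega\colon D(X)\to\pi_0^{BG}(X)$ is $\omega(x)=[\phi_x]$; ${}^{\omega}\pi_0^{BG}(X)$ is the image of $\omega$. $\check D(X)$ is the set of $x\in D(X)$ for which there is $a=(C_E)\in\check\pi_0(X)$ such that for every $E\in\varepsilon(X)$ there is $n_E$ with $\phi^n(x)\in C_E$ for all $n\ge n_E$;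 this $a$ is unique and is denoted $\check\omega(x)$; ${}^{\omega}\check\pi_0(X)$ is the image of $\check\omega\colon\check D(X)\to\check\pi_0(X)$. ${}^{\omega}\pi_0^S(X)=\{a\in\pi_0^S(X)\mid\eta_X(a)\in{}^{\omega}\check\pi_0(X)\}$. $D^S(X)$ is the set of $x\in D(X)$ such that there is $[\alpha]\in\pi_0^S(X)$ with $[\alpha|_{\mathbb{N}}]=[\phi_x]$ in $\pi_0^{BG}(X)$. Basins: $D_a=\omega^{-1}(a)$ for $a\in{}^{\omega}\pi_0^{BG}(X)$; $\check D_a=\check\omega^{-1}(a)$ for $a\in{}^{\omega}\check\pi_0(X)$; $D^S_a=D^S(X)\cap\check D_{\eta_X(a)}$ for $a\in{}^{\omega}\pi_0^S(X)$ (the immediate basin of $a$). The symbols $\sqcup$, $\bigsqcup$ denote disjoint union.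
   Formalization: In the third partition the blocks are the distinct sets D^S_a, not a family indexed by a: classes a≠b with η_X(a)=η_X(b) have the same basin, so the indexed union need not be disjoint (e.g. half-line with a circle at each integer). Blocks D^S_a may be empty. *)

(* Defs.v *)
From HB Require Import structures.
From mathcomp Require Import all_boot all_order all_algebra.
From mathcomp Require Import all_classical all_reals topology normedtype.

Set Implicit Arguments.
Unset Strict Implicit.
Unset Printing Implicit Defensive.

Import Order.TTheory GRing.Theory Num.Theory.
Import numFieldNormedType.Exports.

Local Open Scope classical_set_scope.
Local Open Scope ring_scope.

HB.mixin Record hasExternology X & Topological X := {
  externology : set (set X);
  externology_nonempty : externology !=set0;
  externology_open : forall E, externology E -> open E;
  externologyI : forall E F,
    externology E -> externology F -> externology (E `&` F);
  externology_sup : forall E F,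
    externology E -> open F -> E `<=` F -> externology F
}.

#[short(type="exteriorType")]
HB.structure Definition Exterior := {X of hasExternology X & Topological X}.

Section cocompact.
Variable T : topologicalType.

Definition cocompact : set (set T) :=
  [set E | [/\ open E, closed (~` E) & compact (~` E)]].

Lemma cocompact_nonempty : cocompact !=set0.
Proof.
exists setT; rewrite /cocompact /= setCT.
by split; [exact: openT|exact: closed0|exact: compact0].
Qed.

Lemma cocompact_open E : cocompact E -> open E.
Proof. by case. Qed.

Lemma cocompactI E F : cocompact E -> cocompact F -> cocompact (E `&` F).
Proof.
move=> [oE cE kE] [oF cF kF]; rewrite /cocompact /= setCI.
by split; [exact: openI|exact: closedU|exact: compactU].
Qed.

Lemma cocompact_sup E F : cocompact E -> open F -> E `<=` F -> cocompact F.
Proof.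
move=> [oE cE kE] oF EF; have cF : closed (~` F) by exact: open_closedC.
by split=> //; apply: (subclosed_compact cF kE); exact: subsetC.
Qed.

End cocompact.

HB.instance Definition _ := hasExternology.Build nat
  (@cocompact_nonempty nat) (@cocompact_open nat)
  (@cocompactI nat) (@cocompact_sup nat).

Definition halfline (R : realType) : Type := set_type [set x : R | 0 <= x].

HB.instance Definition _ (R : realType) := Topological.on (halfline R).
HB.instance Definition _ (R : realType) := hasExternology.Build (halfline R)
  (@cocompact_nonempty (halfline R)) (@cocompact_open (halfline R))
  (@cocompactI (halfline R)) (@cocompact_sup (halfline R)).

Definition halfline_of_nat (R : realType) (n : nat) : halfline R :=
  exist _ (n%:R : R) (mem_set (ler0n R n : [set x : R | 0 <= x] n%:R)).

Definition unit_interval (R : realType) : Type :=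
  set_type [set x : R | 0 <= x <= 1].

HB.instance Definition _ (R : realType) := Topological.on (unit_interval R).

Lemma unit_interval0_subproof (R : realType) :
  [set x : R | 0 <= x <= 1] 0.
Proof. by rewrite /= lexx ler01. Qed.

Lemma unit_interval1_subproof (R : realType) :
  [set x : R | 0 <= x <= 1] 1.
Proof. by rewrite /= lexx ler01. Qed.

Definition unit_interval0 (R : realType) : unit_interval R :=
  exist _ 0 (mem_set (unit_interval0_subproof R)).

Definition unit_interval1 (R : realType) : unit_interval R :=
  exist _ 1 (mem_set (unit_interval1_subproof R)).

Section cylinder.
Variables (R : realType) (X : exteriorType).

Definition cylinder : Type := (X * unit_interval R)%type.

HB.instance Definition _ :=
  Topological.copy cylinder (X * unit_interval R)%type.

Definition cylinder_externology : set (set cylinder) :=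
  [set E | open E /\ forall t : unit_interval R,
     exists (U : set (unit_interval R)) (T : set X),
       [/\ open U, U t, externology T & T `*` U `<=` E]].

Lemma cylinder_externology_nonempty : cylinder_externology !=set0.
Proof.
exists setT; split; first exact: openT.
have [T eT] := @externology_nonempty X.
by move=> t; exists setT, T; split => //; exact: openT.
Qed.

Lemma cylinder_externology_open E : cylinder_externology E -> open E.
Proof. by case. Qed.

Lemma cylinder_externologyI E F : cylinder_externology E ->
  cylinder_externology F -> cylinder_externology (E `&` F).
Proof.
move=> [oE hE] [oF hF]; split; first exact: openI.
move=> t; have [U [T [oU Ut eT TUE]]] := hE t.
have [V [S [oV Vt eS SVF]]] := hF t.
exists (U `&` V), (T `&` S); split; [exact: openI|by []|exact: externologyI|].
by move=> [x s] /= [[Tx Sx] [Us Vs]]; split; [exact: TUE|exact: SVF].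
Qed.

Lemma cylinder_externology_sup E F : cylinder_externology E ->
  open F -> E `<=` F -> cylinder_externology F.
Proof.
move=> [oE hE] oF EF; split=> // t; have [U [T [oU Ut eT TUE]]] := hE t.
by exists U, T; split => //; exact: subset_trans EF.
Qed.

HB.instance Definition _ := hasExternology.Build cylinder
  cylinder_externology_nonempty cylinder_externology_open
  cylinder_externologyI cylinder_externology_sup.

End cylinder.

Definition exterior_map (X Y : exteriorType) (f : X -> Y) : Prop :=
  continuous f /\ forall E, externology E -> externology (f @^-1` E).

Definition exterior_homotopic (R : realType) (X Y : exteriorType)
    (f g : X -> Y) : Prop :=
  exists H : cylinder R X -> Y, [/\ exterior_map H,
    forall x, H (x, unit_interval0 R) = f x &
    forall x, H (x, unit_interval1 R) = g x].

Definition exterior_class (R : realType) (X Y : exteriorType) (f : X -> Y) :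
    set (X -> Y) :=
  [set g | exterior_map g /\ exterior_homotopic R f g].

Definition path_component (R : realType) (X : topologicalType)
    (E : set X) (x : X) : set X :=
  [set y | exists p : unit_interval R -> X, [/\ continuous p,
    p (unit_interval0 R) = x, p (unit_interval1 R) = y & range p `<=` E]].

Definition is_path_component (R : realType) (X : topologicalType)
    (E C : set X) : Prop :=
  exists2 x, E x & C = path_component R E x.

Section end_sets.
Variables (R : realType) (X : exteriorType).

Definition pi0_BG : set (set (nat -> X)) :=
  [set exterior_class R f | f in [set f | exterior_map f]].

Definition pi0_S : set (set (halfline R -> X)) :=
  [set exterior_class R f | f in [set f | exterior_map f]].

Definition ext_family : Type := set_type (@externology X) -> set X.

(* The limit over externology X, ordered by inclusion, of the sets of path
   components: a component of E' is mapped to the component of E containing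
   it. *)
Definition pi0_check : set ext_family :=
  [set C | (forall E, is_path_component R (\val E) (C E)) /\
           (forall E E', \val E' `<=` \val E -> C E' `<=` C E)].

(* Only meaningful when exactly one element of pi0_check satisfies P. *)
Definition the_end (P : set ext_family) : ext_family :=
  xget (fun=> set0) (pi0_check `&` P).

Definition eta (a : set (halfline R -> X)) : ext_family :=
  the_end [set C | exists alpha : halfline R -> X,
    [/\ exterior_map alpha, a = exterior_class R alpha &
        forall E, exists r0 : R,
          forall r : halfline R, r0 <= \val r -> C E (alpha r)]].

End end_sets.

Record exterior_discrete_semiflow (X : exteriorType) (phi : nat * X -> X) :
    Prop := {
  semiflow_continuous : continuous phi;
  semiflow0 : forall x, phi (0%N, x) = x;
  semiflowD : forall n m x, phi (n, phi (m, x)) = phi ((n + m)%N, x);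
  semiflow_exterior : exterior_map (fun x => phi (1%N, x))
}.

Section invariance.
Variables (X : exteriorType) (phi : nat * X -> X).

Definition right_invariant (A : set X) : Prop :=
  (fun x => phi (1%N, x)) @` A `<=` A.

Definition left_invariant (A : set X) : Prop :=
  (fun x => phi (1%N, x)) @^-1` A `<=` A.

Definition completely_invariant (A : set X) : Prop :=
  right_invariant A /\ left_invariant A.

End invariance.

Section basins.
Variables (R : realType) (X : exteriorType) (phi : nat * X -> X).

Definition orbit_map (x : X) : nat -> X := fun n => phi (n, x).

Definition D : set X := [set x | exterior_map (orbit_map x)].

Definition omega (x : X) : set (nat -> X) := exterior_class R (orbit_map x).

Definition omega_pi0_BG : set (set (nat -> X)) := omega @` D.

Definition D_basin (a : set (nat -> X)) : set X :=
  D `&` omega @^-1` [set a].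

Definition orbit_converges (x : X) (C : ext_family X) : Prop :=
  forall E, exists n0 : nat, forall n, (n0 <= n)%N -> C E (orbit_map x n).

Definition D_check : set X :=
  [set x | D x /\ exists2 C, pi0_check R C & orbit_converges x C].

Definition omega_check (x : X) : ext_family X :=
  the_end R [set C | orbit_converges x C].

Definition omega_pi0_check : set (ext_family X) := omega_check @` D_check.

Definition D_check_basin (a : ext_family X) : set X :=
  D_check `&` omega_check @^-1` [set a].

Definition omega_pi0_S : set (set (halfline R -> X)) :=
  [set a | pi0_S a /\ omega_pi0_check (eta a)].

Definition D_S : set X :=
  [set x | D x /\ exists2 alpha : halfline R -> X, exterior_map alpha &
     exterior_class R (alpha \o @halfline_of_nat R) =
     exterior_class R (orbit_map x)].

(* This set depends on a only through eta a, and eta need not be injective: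
   distinct a can have the same basin, so the partition of D_S is indexed by
   the set of basins. Unless externology X has a countable base, a basin can
   be empty. *)
Definition D_S_basin (a : set (halfline R -> X)) : set X :=
  D_S `&` D_check_basin (eta a).

End basins.

Arguments omega_pi0_S R {X} phi _.
Arguments D_S_basin R {X} phi a _.

(* T = B \sqcup \bigsqcup_(i in I) F i; the blocks are allowed to be empty. *)
Definition disjoint_decomposition (T K : Type) (B : set T) (I : set K)
    (F : K -> set T) : Prop :=
  [/\ B `|` \bigcup_(i in I) F i = setT,
      forall i, I i -> B `&` F i = set0 &
      trivIset I F].

(* Main.v *)
Require Import Defs.
From mathcomp Require Import all_boot all_order all_algebra.
From mathcomp Require Import all_classical all_reals topology normedtype.
From mathcomp Require Import lra.

Import Order.TTheory GRing.Theory Num.Theory numFieldNormedType.Exports.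

Local Open Scope classical_set_scope.

(** The sets [D] and [D_check] are partitioned by the fibres of [omega] and
    [omega_check], and each index set is the image of the corresponding map, so
    the first two decompositions hold for formal reasons
    ([fiber_decomposition]).

    Invariance comes from the shift on orbits: the orbit of [phi^1(x)] is the
    orbit of [x] without its first point.  The members of the externology of
    [nat] are the cofinite sets, which only see the tail of a sequence, so
    exteriority of the orbit, and the end towards which it converges, are the
    same for [x] and for [phi^1(x)] ([D_phi1], [orbit_converges_phi1]).  Hence
    [D], [D_check] and every fibre of [omega_check] are completely invariant.

    The third decomposition has content: a point [x] of [D_S] has to lie in
    [D_check], with [omega_check x = eta a] for some class [a].  Let [alpha] be
    a ray whose restriction to [nat] has the same class as the orbit of [x],
    and let [E] be a member of the externology.  A tail of [alpha] lies in [E],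
    and since it is itself a path, it stays in a single path component of [E];
    these components form the end [ray_end alpha], which is [eta [alpha]]
    ([ray_end_pi0], [etaE]).  On the other side an exterior homotopy from
    [alpha|nat] to the orbit is, by compactness of the interval, a family of
    paths of which all but finitely many lie entirely in [E]
    ([cylinder_tube], [exterior_homotopic_component]).  So the orbit of [x] is
    eventually in the same component as [alpha], that is, it converges to
    [ray_end alpha] ([ray_end_orbit]).  The end is unique because two path
    components with a common point are equal ([pi0_check_eq]).

    A point in two immediate basins [D_S_basin a] and [D_S_basin b] forces
    [eta a = eta b], so the two basins coincide.  Finally [D_S] is
    right-invariant because composing [alpha] with the exterior map [phi^1]
    gives a ray for [phi^1(x)]; comparing classes, which are defined as sets of
    maps, requires that exterior homotopy of sequences is symmetric and
    transitive.  As [nat] is discrete, such a homotopy amounts to a family of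
    paths ([nat_homotopicP]), and paths can be reversed and concatenated. *)

(** * Paths and path components *)

Section paths.
Local Open Scope ring_scope.
Context {R : realType}.
Implicit Types X : topologicalType.

Lemma continuous_to_set_type {X} (A : set R) (f : X -> A) :
  continuous (set_val \o f) -> continuous f.
Proof. exact: continuous_comp_initial. Qed.

Lemma clamp01_subproof (t : R) :
  Num.max 0 (Num.min t 1) \in [set x : R | 0 <= x <= 1].
Proof. by rewrite inE /= le_max lexx /= ge_max ler01 ge_min lexx orbT. Qed.

(** The retraction of the line onto the interval.  It turns paths on the
    subtype [unit_interval R] into functions on [R], whose reversal and
    concatenation are plain formulas in [R]. *)
Definition clamp01 (t : R) : unit_interval R :=
  exist _ (Num.max 0 (Num.min t 1)) (clamp01_subproof t).

Lemma clamp01_continuous : continuous clamp01.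
Proof.
apply: continuous_to_set_type => t.
apply: (@continuous_max R R (cst 0) (fun t => Num.min t 1)).
  exact: cst_continuous.
apply: (@continuous_min R R id (cst 1)); first exact: cvg_id.
exact: cst_continuous.
Qed.

Lemma clamp01_0 : clamp01 0 = unit_interval0 R.
Proof. by apply: val_inj; rewrite /= minElt ltr01 maxxx. Qed.

Lemma clamp01_1 : clamp01 1 = unit_interval1 R.
Proof. by apply: val_inj; rewrite /= minxx maxElt ltr01. Qed.

Lemma clamp01K : cancel (val : unit_interval R -> R) clamp01.
Proof.
move=> t; apply: val_inj => /=; have := valP t; rewrite inE /= => /andP[t0 t1].
by rewrite (min_idPl t1) (max_idPr t0).
Qed.

Lemma unit_interval_val_continuous : continuous (val : unit_interval R -> R).
Proof. exact: initial_continuous. Qed.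

Lemma unit_interval_compact : compact [set: unit_interval R].
Proof.
rewrite (_ : setT = clamp01 @` `[0, 1]); last first.
  rewrite eqEsubset; split => // t _; exists (val t); last exact: clamp01K.
  by have := valP t; rewrite inE /= in_itv.
apply: continuous_compact; last exact: segment_compact.
exact/continuous_subspaceT/clamp01_continuous.
Qed.

Lemma halfline_clamp_subproof (t : R) :
  Num.max 0 t \in [set x : R | 0 <= x].
Proof. by rewrite inE /= le_max lexx. Qed.

Definition halfline_clamp (t : R) : halfline R :=
  exist _ (Num.max 0 t) (halfline_clamp_subproof t).

Lemma halfline_clamp_continuous : continuous halfline_clamp.
Proof.
apply: continuous_to_set_type => t.
apply: (@continuous_max R R (cst 0) id); first exact: cst_continuous.
exact: cvg_id.
Qed.

Lemma halfline_clampK : cancel (val : halfline R -> R) halfline_clamp.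
Proof.
move=> t; apply: val_inj => /=; have := valP t; rewrite inE /= => t0.
by rewrite (max_idPr t0).
Qed.

Lemma halfline_val_continuous : continuous (val : halfline R -> R).
Proof. exact: initial_continuous. Qed.

Definition concat {X} (q1 q2 : R -> X) (t : R) : X :=
  if t <= 2^-1 then q1 (2 * t) else q2 (2 * t - 1).

Lemma concat0 {X} (q1 q2 : R -> X) : concat q1 q2 0 = q1 0.
Proof. by rewrite /concat invr_ge0 ler0n mulr0. Qed.

Lemma concat1 {X} (q1 q2 : R -> X) : concat q1 q2 1 = q2 1.
Proof.
rewrite /concat ifF; first by congr q2; lra.
by apply/negbTE; rewrite -ltNge; lra.
Qed.

Lemma concat_in {X} (E : set X) (q1 q2 : R -> X) :
  (forall t, E (q1 t)) -> (forall t, E (q2 t)) -> forall t, E (concat q1 q2 t).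
Proof. by move=> E1 E2 t; rewrite /concat; case: ifP. Qed.

Lemma affine_continuous (a b : R) : continuous (fun t : R => a * t + b).
Proof.
move=> t; apply: cvgD; last exact: cvg_cst.
by apply: cvgM; [exact: cvg_cst|exact: cvg_id].
Qed.

(** Pasting along the two closed half-lines that meet at [2^-1]. *)
Lemma concat_continuous {X} (q1 q2 : R -> X) :
  continuous q1 -> continuous q2 -> q1 1 = q2 0 -> continuous (concat q1 q2).
Proof.
move=> c1 c2 q12.
have c1' : continuous (fun t : R => q1 (2 * t)).
  move=> t; apply: (continuous_comp (f := fun t : R => 2 * t)); last exact: c1.
  by apply: cvgM; [exact: cvg_cst|exact: cvg_id].
have c2' : continuous (fun t : R => q2 (2 * t - 1)).
  move=> t; apply: (continuous_comp (f := fun t : R => 2 * t - 1)).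
    exact: affine_continuous.
  exact: c2.
apply/continuous_subspace_setT.
have -> : [set: R] = [set t | t <= 2^-1] `|` [set t | 2^-1 <= t].
  rewrite eqEsubset; split => // t _ /=.
  by apply/orP; exact: le_total.
apply: withinU_continuous; [exact: closed_le|exact: closed_ge| |].
- apply: (subspace_eq_continuous (f := fun t : R => q1 (2 * t))).
    by move=> t; rewrite inE /= => t2; rewrite /from_subspace /concat ifT.
  exact: continuous_subspaceT.
- apply: (subspace_eq_continuous (f := fun t : R => q2 (2 * t - 1))).
    move=> t; rewrite inE /= => t2; rewrite /from_subspace /concat.
    case: ifP => // t2'; have -> : t = 2^-1 by apply/eqP; rewrite eq_le t2 t2'.
    by rewrite mulfV ?pnatr_eq0// subrr.
  exact: continuous_subspaceT.
Qed.

(** Precomposition with the retraction and with the inclusion translates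
    between paths on the interval and functions on the whole line. *)
Lemma path_componentP {X} (E : set X) (x y : X) :
  path_component R E x y <->
  exists q : R -> X, [/\ continuous q, q 0 = x, q 1 = y & forall t, E (q t)].
Proof.
split=> [[p [cp p0 p1 pE]]|[q [cq q0 q1 qE]]].
  exists (p \o clamp01); split => /=; rewrite ?clamp01_0 ?clamp01_1//.
    move=> t; apply: continuous_comp; [exact: clamp01_continuous|exact: cp].
  by move=> t; apply: pE; exists (clamp01 t).
exists (q \o val); split => //; last by move=> _ [t _ <-]; exact: qE.
move=> t; apply: continuous_comp; last exact: cq.
exact: unit_interval_val_continuous.
Qed.

Lemma reverse_continuous {X} (q : R -> X) :
  continuous q -> continuous (fun t : R => q (1 - t)).
Proof.
move=> cq t; apply: (continuous_comp (f := fun t : R => 1 - t)); last exact: cq.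
by apply: cvgB; [exact: cvg_cst|exact: cvg_id].
Qed.

Lemma path_component_sym {X} (E : set X) x y :
  path_component R E x y -> path_component R E y x.
Proof.
move=> /path_componentP[q [cq q0 q1 qE]]; apply/path_componentP.
exists (fun t : R => q (1 - t)); split; rewrite ?subr0 ?subrr//.
exact: reverse_continuous.
Qed.

Lemma path_component_trans {X} (E : set X) x y z :
  path_component R E x y -> path_component R E y z -> path_component R E x z.
Proof.
move=> /path_componentP[q1 [cq1 q10 q11 q1E]].
move=> /path_componentP[q2 [cq2 q20 q21 q2E]]; apply/path_componentP.
exists (concat q1 q2); split; rewrite ?concat0 ?concat1//.
  by apply: concat_continuous; rewrite ?q11 ?q20.
exact: concat_in.
Qed.

Lemma path_componentS {X} (E F : set X) x y :
  E `<=` F -> path_component R E x y -> path_component R F x y.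
Proof.
move=> EF /path_componentP[q [cq q0 q1 qE]]; apply/path_componentP.
by exists q; split => // t; exact: EF.
Qed.

Lemma is_path_component_closed {X} (E C : set X) x y :
  is_path_component R E C -> C x -> path_component R E x y -> C y.
Proof. by move=> [z Ez ->]; exact: path_component_trans. Qed.

Lemma is_path_component_eq {X} (E C C' : set X) x :
  is_path_component R E C -> is_path_component R E C' -> C x -> C' x -> C = C'.
Proof.
move=> [y Ey ->] [z Ez ->] yx zx.
suff sub u v : path_component R E u x -> path_component R E v x ->
    path_component R E u `<=` path_component R E v.
  by rewrite eqEsubset; split; exact: sub.
move=> ux vx w; apply: path_component_trans; apply: path_component_trans vx _.
exact: path_component_sym.
Qed.

End paths.

(** * Exterior maps and exterior homotopies *)

Lemma nat_externologyP (A : set nat) :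
  externology A <-> exists n0, forall n, (n0 <= n)%N -> A n.
Proof.
split=> [[_ _ /compact_near_coveringP kA]|[n0 An0]].
  (* Compactness makes the statement n < N, true near each n for large N,
     uniform on the complement of A. *)
  have [|N _ NA] := kA nat \oo (fun N n => (n < N)%N) _.
    move=> n _; exists ([set n], [set N | (n < N)%N]).
      by split; [exact: discrete_set1|exact: nbhs_infty_gt].
    by move=> [m N] [/= ->].
  exists N => n Nn; apply: contrapT => /(NA N (leqnn N)).
  by rewrite ltnNge Nn.
split; [exact: discrete_open|exact: discrete_closed|apply: finite_compact].
apply: (sub_finite_set _ (finite_II n0)) => n /= An.
by rewrite ltnNge; apply/negP => /An0.
Qed.

Section homotopy.
Local Open Scope ring_scope.
Context {R : realType}.
Implicit Types X Y Z : exteriorType.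

Lemma exterior_comp {X Y Z} (f : X -> Y) (g : Y -> Z) :
  exterior_map f -> exterior_map g -> exterior_map (g \o f).
Proof.
move=> [cf ef] [cg eg]; split.
  by move=> x; apply: (continuous_comp (cf x)); exact: cg.
by move=> E /eg /ef.
Qed.

Lemma exterior_homotopic_refl {X Y} (f : X -> Y) :
  exterior_map f -> exterior_homotopic R f f.
Proof.
move=> [cf ef]; exists (f \o fst); split => //; split.
  by move=> x; apply: continuous_comp; [exact: cvg_fst|exact: cf].
move=> E eE; split => [|t].
  apply: open_comp; last exact: externology_open.
  by move=> x _; apply: continuous_comp; [exact: cvg_fst|exact: cf].
exists setT, (f @^-1` E); split => //; [exact: openT|exact: ef|].
by move=> [x s] [].
Qed.

Lemma exterior_homotopic_comp {X Y Z} (f g : X -> Y) (h : Y -> Z) :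
  exterior_map h -> exterior_homotopic R f g ->
  exterior_homotopic R (h \o f) (h \o g).
Proof.
move=> hh [H [eH H0 H1]]; exists (h \o H).
by split => [|x|x] /=; [exact: exterior_comp|rewrite H0|rewrite H1].
Qed.

(** By reflexivity of exterior homotopy, [g] is an element of its own class. *)
Lemma exterior_class_homotopic {X Y} (f g : X -> Y) :
  exterior_map g -> exterior_class R f = exterior_class R g ->
  exterior_homotopic R f g.
Proof.
move=> eg fg.
have : exterior_class R g g by split => //; exact: exterior_homotopic_refl.
by rewrite -fg => -[].
Qed.

(** The tube lemma: a member of the externology of the cylinder contains the
    sets [T_t `*` U_t], and compactness of the interval yields one [T] that is
    valid for all [t]. *)
Lemma cylinder_tube {X} (E : set (cylinder R X)) : externology E ->
  exists2 T : set X, externology T & forall x, T x -> forall t, E (x, t).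
Proof.
move=> [_ tE].
have /compact_near_coveringP/(_ _ (filter_from (@externology X) id)) :=
  @unit_interval_compact R.
move=> /(_ (fun x t => E (x, t))) [].
- apply: filter_from_filter; first exact: externology_nonempty.
  move=> T S eT eS; exists (T `&` S) => //; exact: externologyI.
- move=> t _; have [U [T [oU Ut eT TUE]]] := tE t.
  exists (U, T) => /=; last by move=> [s x] [/= Us Tx]; exact: TUE.
  by split; [exact: open_nbhs_nbhs|exists T].
- by move=> T eT TE; exists T => // x Tx t; exact: TE.
Qed.

Lemma homotopy_path_continuous {X Y} (H : cylinder R X -> Y) x :
  continuous H -> continuous (fun t => H (x, t)).
Proof.
move=> cH t.
apply: (continuous_comp (f := fun t => (x, t) : cylinder R X)); last exact: cH.
move=> U [[A B] /= [Ax Bt] ABU]; apply: filterS Bt => s Bs; apply: ABU.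
by split => //=; exact: nbhs_singleton.
Qed.

(** Two exterior homotopic maps are indistinguishable by path components:
    near infinity, the track of each point is a path inside [E]. *)
Lemma exterior_homotopic_component {X Y} (f g : X -> Y) (E : set Y) :
  exterior_homotopic R f g -> externology E ->
  exists2 T : set X, externology T &
    forall x, T x -> path_component R E (f x) (g x).
Proof.
move=> [H [[cH eH] H0 H1]] /eH/cylinder_tube[T eT TE]; exists T => // x Tx.
exists (fun t => H (x, t)); split => //; first exact: homotopy_path_continuous.
by move=> _ [t _ <-]; exact: TE.
Qed.

(** A compact subset of the half-line is bounded. *)
Lemma halfline_externology_tail (A : set (halfline R)) : externology A ->
  exists r0 : R, forall r : halfline R, r0 <= val r -> A r.
Proof.
move=> [_ _ kA].
have : compact (val @` ~` A).
  apply: continuous_compact kA; apply: continuous_subspaceT.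
  exact: halfline_val_continuous.
move=> /compact_bounded[M [Mreal MA]].
exists (M + 2) => r rM; apply: contrapT => Ar.
have := MA (M + 1); rewrite ltrDl ltr01 => /(_ erefl (val r)).
move=> /(_ (ex_intro2 _ _ r Ar erefl)) /(le_trans (ler_norm _)).
by move: rM; lra.
Qed.

(** Since [nat] is discrete, continuity of a homotopy of sequences is a
    condition on each track separately; only the externology relates the
    tracks.  Homotopies can thus be combined track by track, without pasting
    on the cylinder. *)
Lemma nat_homotopicP {X} (f g : nat -> X) :
  exterior_homotopic R f g <->
  exists q : nat -> R -> X,
    [/\ forall n, continuous (q n), forall n, q n 0 = f n,
        forall n, q n 1 = g n & forall E, externology E ->
          exists n0, forall n, (n0 <= n)%N -> forall t, E (q n t)].
Proof.
split=> [[H [[cH eH] H0 H1]]|[q [cq q0 q1 qE]]].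
  exists (fun n t => H (n, clamp01 t)); split=> [n t|n|n|E /eH/cylinder_tube].
  - apply: (continuous_comp (g := fun t => H (n, t))).
      exact: clamp01_continuous.
    exact: homotopy_path_continuous.
  - by rewrite clamp01_0.
  - by rewrite clamp01_1.
  - move=> [T /nat_externologyP[n0 Tn0] TE].
    by exists n0 => n n0n t; apply: TE; exact: Tn0.
have cH : continuous ((fun z => q z.1 (val z.2)) : cylinder R nat -> X).
  have cqv n : continuous (fun t : unit_interval R => q n (val t)).
    move=> t; apply: continuous_comp; last exact: cq.
    exact: unit_interval_val_continuous.
  move=> [n t] U /= Un; exists ([set n], (fun t => q n (val t)) @^-1` U) => /=.
    by split; [exact: discrete_set1|exact: cqv Un].
  by move=> [m s] [/= -> ].
exists (fun z => q z.1 (val z.2)); split => //; split => // E eE.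
split => [|t].
  by apply: open_comp => [z _|]; [exact: cH|exact: externology_open].
have [n0 En0] := qE E eE.
exists setT, [set n | (n0 <= n)%N]; split => //; first exact: openT.
  by apply/nat_externologyP; exists n0.
by move=> [n s] [/= n0n _]; exact: En0.
Qed.

Lemma nat_homotopic_sym {X} (f g : nat -> X) :
  exterior_homotopic R f g -> exterior_homotopic R g f.
Proof.
move=> /nat_homotopicP[q [cq q0 q1 qE]]; apply/nat_homotopicP.
exists (fun n t => q n (1 - t)); split => [n|n|n|E /qE[n0 En0]].
- exact: reverse_continuous.
- by rewrite subr0.
- by rewrite subrr.
- by exists n0 => n n0n t; exact: En0.
Qed.

Lemma nat_homotopic_trans {X} (f g h : nat -> X) :
  exterior_homotopic R f g -> exterior_homotopic R g h ->
  exterior_homotopic R f h.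
Proof.
move=> /nat_homotopicP[q [cq q0 q1 qE]] /nat_homotopicP[p [cp p0 p1 pE]].
apply/nat_homotopicP; exists (fun n => concat (q n) (p n)).
split=> [n|n|n|E eE]; rewrite ?concat0 ?concat1//.
  by apply: concat_continuous; rewrite ?q1 ?p0.
have [[n0 En0] [m0 Em0]] := (qE E eE, pE E eE).
exists (maxn n0 m0) => n; rewrite geq_max => /andP[n0n m0n].
by apply: concat_in => t; [exact: En0|exact: Em0].
Qed.

Lemma nat_class_eq {X} (f g : nat -> X) :
  exterior_homotopic R f g -> exterior_class R f = exterior_class R g.
Proof.
move=> fg; rewrite eqEsubset; split => h [eh hh]; split => //.
  exact: nat_homotopic_trans (nat_homotopic_sym _ _ fg) hh.
exact: nat_homotopic_trans fg hh.
Qed.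

End homotopy.

(** * The end of an exterior ray *)

Section ends.
Local Open Scope ring_scope.
Context {R : realType} {X : exteriorType}.
Implicit Types (C : ext_family X) (alpha : halfline R -> X).

(** Path components that meet are equal, so an end is determined by one point
    of each of its members. *)
Lemma pi0_check_eq C C' : pi0_check R C -> pi0_check R C' ->
  (forall E, C E `&` C' E !=set0) -> C = C'.
Proof.
move=> [hC _] [hC' _] CC'; apply/funext => E; have [x [Cx C'x]] := CC' E.
exact: is_path_component_eq (hC E) (hC' E) Cx C'x.
Qed.

Lemma the_endE (P : set (ext_family X)) C : pi0_check R C -> P C ->
  (forall C', pi0_check R C' -> P C' -> forall E, C E `&` C' E !=set0) ->
  the_end R P = C.
Proof.
move=> hC PC uniq; apply: xget_unique => // C' [hC' PC'].
by apply: pi0_check_eq => // E; rewrite setIC; exact: uniq.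
Qed.

Definition ray_converges alpha C :=
  forall E, exists r0 : R, forall r : halfline R, r0 <= val r -> C E (alpha r).

(** The path runs linearly from [r] to [s] along the ray.  The maximum with
    [r0] confines to the tail also the values at parameters outside the unit
    interval, which [path_componentP] asks for. *)
Lemma halfline_path alpha (E : set X) (r0 : R) (r s : halfline R) :
  continuous alpha -> (forall r : halfline R, r0 <= val r -> E (alpha r)) ->
  r0 <= val r -> r0 <= val s -> path_component R E (alpha r) (alpha s).
Proof.
move=> ca aE r0r r0s; apply/path_componentP.
exists (fun t => alpha (halfline_clamp
  (Num.max r0 ((val s - val r) * t + val r)))).
split=> [t|||t].
- apply: continuous_comp; last exact: ca.
  apply: continuous_comp; last exact: halfline_clamp_continuous.
  apply: (@continuous_max R R (cst r0)).
    exact: cst_continuous.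
  exact: affine_continuous.
- by rewrite mulr0 add0r (max_idPr r0r) halfline_clampK.
- by rewrite mulr1 subrK (max_idPr r0s) halfline_clampK.
- by apply: aE => /=; rewrite !le_max lexx orbT.
Qed.

(** The component of [E] that contains a tail of [alpha], described without
    the choice of a point on the tail, so that compatibility with inclusions is
    immediate. *)
Definition ray_end alpha : ext_family X := fun E =>
  [set y | exists r0 : R, forall r : halfline R, r0 <= val r ->
     path_component R (val E) (alpha r) y].

Lemma ray_tail alpha (E : set_type (@externology X)) : exterior_map alpha ->
  exists r0 : R, forall r : halfline R, r0 <= val r -> val E (alpha r).
Proof.
move=> [_ ea]; apply: (halfline_externology_tail (alpha @^-1` val E)).
by apply: ea; exact: (set_mem (valP E)).
Qed.

Lemma ray_end_pi0 alpha : exterior_map alpha -> pi0_check R (ray_end alpha).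
Proof.
move=> ea; split=> [E|E E' E'E y [r0 hy]]; last first.
  by exists r0 => r r0r; exact: path_componentS (hy r r0r).
have [r0 Er0] := ray_tail alpha E ea; pose s := halfline_clamp r0.
have r0s : r0 <= val s by rewrite /= le_max lexx orbT.
exists (alpha s); first exact: Er0.
rewrite eqEsubset; split => [y [r1 hy]|y sy].
  pose r := halfline_clamp (Num.max r0 r1).
  have r0r : r0 <= val r by rewrite /= !le_max lexx orbT.
  have r1r : r1 <= val r by rewrite /= !le_max lexx !orbT.
  apply: path_component_trans (hy r r1r).
  exact: halfline_path (proj1 ea) Er0 r0s r0r.
exists r0 => r r0r; apply: path_component_trans sy.
exact: halfline_path (proj1 ea) Er0 r0r r0s.
Qed.

Lemma ray_end_converges alpha :
  exterior_map alpha -> ray_converges alpha (ray_end alpha).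
Proof.
move=> ea E; have [r0 Er0] := ray_tail alpha E ea.
exists r0 => s r0s; exists r0 => r r0r.
exact: halfline_path (proj1 ea) Er0 r0r r0s.
Qed.

(** [ray_end alpha] is one of the candidates for [eta]; any other candidate
    is attached to a ray homotopic to [alpha], which is joined to [alpha] inside
    [E] near infinity, so the two components meet. *)
Lemma etaE alpha :
  exterior_map alpha -> eta (exterior_class R alpha) = ray_end alpha.
Proof.
move=> ea; apply: the_endE; first exact: ray_end_pi0.
  by exists alpha; split => //; exact: ray_end_converges.
move=> C [hC _] [beta [eb ab bC]] E.
have ba := exterior_class_homotopic beta alpha ea (esym ab).
have [T /halfline_externology_tail[r0 Tr0] TE] :=
  exterior_homotopic_component _ _ _ ba (set_mem (valP E)).
have [[r1 Cr1] [r2 Cr2]] := (bC E, ray_end_converges alpha ea E).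
pose r := halfline_clamp (Num.max r0 (Num.max r1 r2)).
have r0r : r0 <= val r by rewrite /= !le_max lexx !orbT.
have r1r : r1 <= val r by rewrite /= !le_max lexx !orbT.
have r2r : r2 <= val r by rewrite /= !le_max lexx !orbT.
exists (alpha r); split; first exact: Cr2.
exact: is_path_component_closed (hC E) (Cr1 r r1r) (TE r (Tr0 r r0r)).
Qed.

End ends.

(** * Orbits and the action of the time-one map *)

Section semiflow.
Context {R : realType} {X : exteriorType} {phi : nat * X -> X}.
Hypothesis hphi : exterior_discrete_semiflow phi.
Implicit Types (x : X) (C : ext_family X).

Local Notation phi1 x := (phi (1%N, x)).

Lemma D_tail x : D phi x <->
  forall E : set X, externology E ->
    exists n0, forall n, (n0 <= n)%N -> E (phi (n, x)).
Proof.
split=> [[_ ex] E /ex /nat_externologyP|hx]; first exact.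
split=> [n U /nbhs_singleton Un|E /hx En]; first exact/principal_filterP.
by apply/nat_externologyP.
Qed.

Lemma orbit_shift x n : phi (n, phi1 x) = phi (n.+1, x).
Proof. by rewrite (semiflowD hphi) addn1. Qed.

Lemma eventually_shift x (A : set X) :
  (exists n0, forall n, (n0 <= n)%N -> A (phi (n, phi1 x))) <->
  (exists n0, forall n, (n0 <= n)%N -> A (phi (n, x))).
Proof.
split=> -[n0 An0].
  by exists n0.+1 => -[//|n] n0n; rewrite -orbit_shift; exact: An0.
by exists n0 => n n0n; rewrite orbit_shift; apply: An0; exact: ltnW.
Qed.

Lemma D_phi1 x : D phi (phi1 x) <-> D phi x.
Proof.
by split=> /D_tail hx; apply/D_tail => E eE; apply/(eventually_shift x E);
  exact: hx.
Qed.

Lemma orbit_converges_phi1 x C :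
  orbit_converges phi (phi1 x) C = orbit_converges phi x C.
Proof.
by apply/propext; split=> hx E; apply/(eventually_shift x (C E)); exact: hx.
Qed.

Lemma D_check_phi1 x : D_check R phi (phi1 x) <-> D_check R phi x.
Proof.
by split=> -[/D_phi1 Dx [C hC xC]]; split => //; exists C => //;
  move: xC; rewrite orbit_converges_phi1.
Qed.

Lemma omega_check_phi1 x : omega_check R phi (phi1 x) = omega_check R phi x.
Proof.
by rewrite /omega_check; under eq_fun do rewrite orbit_converges_phi1.
Qed.

Lemma omega_checkE x C :
  pi0_check R C -> orbit_converges phi x C -> omega_check R phi x = C.
Proof.
move=> hC xC; apply: the_endE => // C' hC' xC' E.
have [[n Cn] [n' Cn']] := (xC E, xC' E).
by exists (phi (maxn n n', x)); split;
  [apply: Cn; exact: leq_maxl|apply: Cn'; exact: leq_maxr].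
Qed.

(** Near infinity the homotopy from [alpha|nat] to the orbit of [x] gives
    paths inside [E] from [alpha n], a point of the end of [alpha], to
    [phi (n, x)]. *)
Lemma ray_end_orbit (alpha : halfline R -> X) x :
  exterior_map alpha -> D phi x ->
  exterior_class R (alpha \o @halfline_of_nat R) =
    exterior_class R (orbit_map phi x) ->
  orbit_converges phi x (ray_end alpha).
Proof.
move=> ea Dx ax E.
have [T /nat_externologyP[n0 Tn0] TE] := exterior_homotopic_component _ _ _
  (exterior_class_homotopic _ _ Dx ax) (set_mem (valP E)).
have [r0 Cr0] := ray_end_converges alpha ea E.
exists (maxn n0 (Num.truncn r0).+1) => n; rewrite geq_max => /andP[n0n r0n].
apply: (is_path_component_closed _ _ _ _ (proj1 (ray_end_pi0 alpha ea) E)).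
  apply: (Cr0 (halfline_of_nat R n)) => /=.
  by apply/ltW/(lt_le_trans (truncnS_gt _)); rewrite ler_nat.
exact/TE/Tn0.
Qed.

(** Any ray [alpha] witnessing [D_S x] gives an index: [x] lies in the immediate
    basin of the class of [alpha]. *)
Lemma D_S_end x : D_S R phi x ->
  exists2 a, omega_pi0_S R phi a & D_S_basin R phi a x.
Proof.
move=> Sx; have [Dx [alpha ea ax]] := Sx.
have xC := ray_end_orbit alpha x ea Dx ax.
have Cx : D_check R phi x.
  by split => //; exists (ray_end alpha) => //; exact: ray_end_pi0.
have ox : omega_check R phi x = eta (exterior_class R alpha).
  by rewrite etaE//; apply: omega_checkE => //; exact: ray_end_pi0.
exists (exterior_class R alpha); last by split.
by split; [exists alpha|exists x].
Qed.

(** The ray for [phi^1(x)] is [phi^1 \o alpha]: composing with the exterior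
    map [phi^1] preserves homotopies, and [phi^1] applied to the orbit of [x] is
    the orbit of [phi^1(x)]. *)
Lemma D_S_phi1 x : D_S R phi x -> D_S R phi (phi1 x).
Proof.
move=> [Dx [alpha ea ax]]; split; first exact/D_phi1.
have e1 := semiflow_exterior hphi.
exists ((fun x => phi1 x) \o alpha); first exact: exterior_comp.
apply: nat_class_eq.
have -> : orbit_map phi (phi1 x) = (fun x => phi1 x) \o orbit_map phi x.
  by apply/funext => n /=; rewrite /orbit_map !(semiflowD hphi) addnC.
exact: exterior_homotopic_comp e1 (exterior_class_homotopic _ _ Dx ax).
Qed.

Lemma completely_invariant_iff (A : set X) :
  (forall x, A (phi1 x) <-> A x) -> completely_invariant phi A.
Proof. by move=> hA; split=> [_ [x Ax <-]|x /hA//]; exact/hA. Qed.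

End semiflow.

(** * The partitions *)

Lemma fiber_decomposition (T K : Type) (A : set T) (f : T -> K) :
  disjoint_decomposition (~` A) (f @` A) (fun a => A `&` f @^-1` [set a]).
Proof.
split=> [|a _|a b _ _ [x [[_ <-] [_ <-]]]//].
  rewrite eqEsubset; split => // x _.
  have [Ax|] := pselect (A x); last by left.
  by right; exists (f x) => //; exists x.
by rewrite setIA setICl set0I.
Qed.

Theorem corollary6p1 (R : realType) (X : exteriorType) (phi : nat * X -> X)
    (hphi : exterior_discrete_semiflow phi) :
  [/\ disjoint_decomposition (~` D phi)
        (omega_pi0_BG R phi) (D_basin R phi),
      forall a, omega_pi0_BG R phi a -> D_basin R phi a !=set0,
      disjoint_decomposition (~` D_check R phi)
        (omega_pi0_check R phi) (D_check_basin R phi),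
      forall a, omega_pi0_check R phi a -> D_check_basin R phi a !=set0 &
      disjoint_decomposition (~` D_S R phi)
        [set D_S_basin R phi a | a in omega_pi0_S R phi] id]
  /\
  [/\ completely_invariant phi (~` D phi),
      completely_invariant phi (~` D_check R phi),
      forall a, omega_pi0_check R phi a ->
        completely_invariant phi (D_check_basin R phi a) &
      forall a, omega_pi0_S R phi a ->
        right_invariant phi (D_S_basin R phi a)].
Proof.
split; split.
- exact: fiber_decomposition.
- by move=> _ [x Dx <-]; exists x.
- exact: fiber_decomposition.
- by move=> _ [x Dx <-]; exists x.
- split=> [|_ [a _ <-]|_ _ [a _ <-] [b _ <-]].
  + rewrite eqEsubset; split => // x _.
    have [/D_S_end[a wa ax]|] := pselect (D_S R phi x); last by left.
    by right; exists (D_S_basin R phi a) => //; exists a.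
  + by rewrite /D_S_basin setIA setICl set0I.
  (* A common point x gives eta a = omega_check x = eta b, and a basin depends
     on its index only through eta. *)
  + by move=> [x [[_ [_ xa]] [_ [_ xb]]]]; rewrite /D_S_basin -xa -xb.
- apply: completely_invariant_iff => x; have [xD Dx] := D_phi1 hphi x.
  by split; exact: contra_not.
- apply: completely_invariant_iff => x.
  have [xD Dx] := @D_check_phi1 R _ _ hphi x.
  by split; exact: contra_not.
- move=> a _; apply: completely_invariant_iff => x.
  by rewrite /D_check_basin /setI /= (omega_check_phi1 hphi); split=> -[];
    move=> /(D_check_phi1 hphi).
- move=> a _ _ [x [/(D_S_phi1 hphi) Sx [/(D_check_phi1 hphi) Cx xa]] <-].
  by do 2!split => //; rewrite /= (omega_check_phi1 hphi).
Qed.
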